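(* Let $\lambda\in(0,1]$, $\gamma\in[0,1)$, $\delta\in(0,(1-\gamma)/2)$ and let $k\ge 0$ be an integer. Suppose the integer variables $M$ and $n$ satisfy the inequalities $k\le n\le M$ and $M=n/\lambda+O(n^{\gamma})$, uniformly in $\lambda$ and $k$, as $n$ tends to infinity while $\gamma$ is fixed. Let $\mathcal{M}$ be a set with $M$ elements, let $\mathcal{N}\subset\mathcal{M}$ be a subset with $n$ elements, and let $\mathcal{T}=\mathcal{M}^n$. Then $$\frac{1}{|\mathcal{T}|}\cdot\left|\left\{\mathbf{x}\in\mathcal{T} :\ \left|\frac{m_k(\mathbf{x})}{n}-\frac{\lambda^k}{k!}e^{-\lambda}\right|<n^{-\delta}\right\}\right| = 1-O\left(\frac{\lambda^k}{k!}\cdot\frac{1}{n^{1-2\delta}}\left(1+\frac{\lambda^{k+1}(\lambda+k)}{k!}n^{\gamma}\right)\right),$$ and the constant involved in the big-$O$ term of this conclusion does not depend on $\lambda,\gamma,\delta$ and $k$.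
   Context: For a finite set $\mathcal{M}$ with $M$ elements and a subset $\mathcal{N}\subset\mathcal{M}$ with $n$ elements, $\mathcal{T}=\mathcal{M}^n$ is the set of $n$-tuples $\mathbf{x}=(x_1,\dots,x_n)$ with components in $\mathcal{M}$. An element $y\in\mathcal{N}$ is represented exactly $k$ times in $\mathbf{x}\in\mathcal{T}$ if exactly $k$ of the components $x_1,\dots,x_n$ are equal to $y$. The counter $m_k(\mathbf{x})$ is the number of elements $y\in\mathcal{N}$ that are represented exactly $k$ times in $\mathbf{x}$. The hypothesis $M=n/\lambda+O(n^\gamma)$ ''uniformly in $\lambda$ and $k$'' means that the constant implied in this $O$ does not depend on $\lambda$ and $k$. *)

(* Defs.v *)
From mathcomp Require Import all_boot all_order all_algebra.
From mathcomp Require Import all_classical all_reals all_analysis.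

Set Implicit Arguments.
Unset Strict Implicit.
Unset Printing Implicit Defensive.

Import Order.TTheory GRing.Theory Num.Theory.
Local Open Scope ring_scope.

(* A tuple x represents y exactly k times when count_mem y x == k; this is the
   counter m_k(x). *)
Definition rep_count (T : finType) (A : {set T}) (k n : nat)
    (x : n.-tuple T) : nat :=
  #|[set y in A | count_mem y x == k]%SET|.

Definition concentrated (R : realType) (T : finType) (A : {set T})
    (k n : nat) (lambda delta : R) : {set n.-tuple T} :=
  [set x : n.-tuple T |
     `|(rep_count A k x)%:R / n%:R
         - lambda ^+ k / (k`!)%:R * expR (- lambda)|
       < n%:R `^ (- delta)]%SET.

Definition concentrated_freq (R : realType) (T : finType) (A : {set T})
    (k n : nat) (lambda delta : R) : R :=
  #|concentrated A k n lambda delta|%:R / #|{: n.-tuple T}|%:R.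

(* Main.v *)
Require Import Defs.
From mathcomp Require Import all_boot all_order all_algebra.
From mathcomp Require Import all_classical all_reals all_analysis.
From mathcomp Require Import zify ring lra.

Set Implicit Arguments.
Unset Strict Implicit.
Unset Printing Implicit Defensive.

Import Order.TTheory GRing.Theory Num.Theory.
Local Open Scope ring_scope.

(** Put M = #|T|, q = 1/M, mu = n/M, e = n^(-delta), and let p be the binomial
    probability that a given letter occurs exactly k times in a uniform random
    word of length n. The frequency of concentrated words is at most 1, so only
    a lower bound is needed, and two regimes give it.

    When k * e >= 1 every word is concentrated: the letters represented k times
    occupy disjoint sets of k positions, so m_k / n <= 1/k <= e, and the Poisson
    probability lies below 1/k too ([concentrated_freq_eq1]). This case has to
    be treated apart, because for such large k the ratio (mu / lambda)^k need not
    be bounded.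

    When k * e < 1 the bound is the second moment method. The mean of m_k is
    n * p. For two distinct letters the events of being represented k times are
    almost negatively correlated ([multinomial_pmf_le]), so the variance of m_k
    is at most 3 * n * mu^k / k! ([variance_rep_count]). The mean p is compared
    with the Poisson probability of parameter mu with error 5/n
    ([binomial_poisson]), and that one with the Poisson probability of parameter
    lambda with error 2 * |mu - lambda| = O(n^(gamma - 1))
    ([poisson_lipschitz]). With eta = (1 - gamma)/2, both errors are
    O(n^(-2 * eta)) for each fixed gamma, hence below e/2 for large n since delta < eta.
    Chebyshev's inequality then bounds the exceptional frequency by
    12 * (mu^k / k!) / (n * e^2) ([concentrated_freq_chebyshev]), and mu^k is at
    most a constant times lambda^k because k * n^(-eta) <= k * e < 1. The
    implied constant C(gamma) only enters the threshold on n, which is why the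
    final constant depends on neither gamma nor C. *)

(** * Counting words by the multiplicity of one or two letters *)

Lemma sum_tuple_cons (T : finType) n (F : n.+1.-tuple T -> nat) :
  (\sum_(x : n.+1.-tuple T) F x =
   \sum_(t : T) \sum_(x : n.-tuple T) F (cons_tuple t x))%N.
Proof.
rewrite pair_big /=.
apply: (reindex (fun p : T * n.-tuple T => cons_tuple p.1 p.2)).
exists (fun x : n.+1.-tuple T => (thead x, behead_tuple x)).
  by case=> t x _; rewrite /thead tnth0; congr pair; apply: val_inj.
by move=> x _; rewrite [RHS]tuple_eta; apply: val_inj.
Qed.

Lemma sum_letter (T : finType) (y : T) (f : bool -> nat) :
  (\sum_(t : T) f (t == y) = f true + #|T|.-1 * f false)%N.
Proof.
rewrite (bigD1 y) //= eqxx; congr addn.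
rewrite (eq_bigr (fun=> f false)) => [|t /negbTE -> //].
by rewrite sum_nat_const cardC1.
Qed.

Lemma sum_two_letters (T : finType) (y z : T) (f : bool -> bool -> nat) :
  y != z ->
  (\sum_(t : T) f (t == y) (t == z) =
     f true false + f false true + (#|T| - 2) * f false false)%N.
Proof.
move=> yz; rewrite (bigD1 y) //= eqxx (negbTE yz) -addnA; congr addn.
rewrite (bigD1 z) /=; last by rewrite eq_sym.
rewrite eqxx eq_sym (negbTE yz); congr addn.
rewrite (eq_bigr (fun=> f false false)) => [|t /andP[/negbTE-> /negbTE-> //]].
rewrite sum_nat_const; congr muln.
transitivity #|~: [set y; z]|; last by rewrite cardsCs finset.setCK cards2 yz.
by apply: eq_card => t; rewrite !inE negb_or.
Qed.

(** Induction on the length: splitting off the first letter turns the count into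
    Pascal's rule. *)
Lemma sum_count_eq (T : finType) (y : T) n k :
  (\sum_(x : n.-tuple T) (count_mem y x == k) =
   'C(n, k) * #|T|.-1 ^ (n - k))%N.
Proof.
elim: n k => [|n IHn] k.
  rewrite (big_pred1 [tuple]) => [|x]; last by rewrite (tuple0 x) /= eqxx.
  by case: k => [|k]; rewrite ?muln1.
rewrite sum_tuple_cons.
transitivity (\sum_(t : T) \sum_(x : n.-tuple T)
                ((t == y) + count_mem y x == k))%N.
  by apply: eq_bigr => t _; apply: eq_bigr => x _ /=; rewrite eq_sym.
rewrite (sum_letter y (fun b => \sum_(x : n.-tuple T) (b + count_mem y x == k)))%N.
rewrite IHn; case: k => [|k].
  rewrite big1 // !bin0 !mul1n !subn0 expnS; lia.
rewrite (eq_bigr (fun x : n.-tuple T => (count_mem y x == k) : nat)) // IHn.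
rewrite binS subSS; have [nk|kn] := leqP n k.
  by rewrite (bin_small (n := n) (m := k.+1)) ?mul0n ?muln0 ?addn0.
have -> : (n - k = (n - k.+1).+1)%N by lia.
rewrite expnS; lia.
Qed.

(** The same induction for two letters: the first one is [y], [z] or neither, and
    the three resulting terms recombine by Pascal's rule in both binomials. *)
Lemma sum_count_eq2 (T : finType) (y z : T) n a b : y != z ->
  (\sum_(x : n.-tuple T) ((count_mem y x == a) && (count_mem z x == b)) =
   'C(n, a) * 'C(n - a, b) * (#|T| - 2) ^ (n - a - b))%N.
Proof.
move=> yz; elim: n a b => [|n IHn] a b.
  rewrite (big_pred1 [tuple]) => [|x]; last by rewrite (tuple0 x) /= eqxx.
  by case: a b => [|a] [|b]; rewrite ?muln1 ?muln0.
rewrite sum_tuple_cons.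
transitivity (\sum_(t : T) \sum_(x : n.-tuple T)
   (((t == y) + count_mem y x == a) && ((t == z) + count_mem z x == b)))%N.
  apply: eq_bigr => t _; apply: eq_bigr => x _ /=.
  by rewrite (eq_sym t) (eq_sym t).
rewrite (sum_two_letters (fun c d => \sum_(x : n.-tuple T)
   ((c + count_mem y x == a) && (d + count_mem z x == b)))%N yz).
rewrite IHn.
have E1 : (\sum_(x : n.-tuple T)
     ((true + count_mem y x == a) && (false + count_mem z x == b)) =
     if a is a'.+1 then 'C(n, a') * 'C(n - a', b) * (#|T| - 2) ^ (n - a' - b)
     else 0)%N.
  case: a => [|a]; first by rewrite big1.
  by rewrite -IHn; apply: eq_bigr => x _.
have E2 : (\sum_(x : n.-tuple T)
     ((false + count_mem y x == a) && (true + count_mem z x == b)) =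
     if b is b'.+1 then 'C(n, a) * 'C(n - a, b') * (#|T| - 2) ^ (n - a - b')
     else 0)%N.
  clear E1; case: b => [|b]; first by rewrite big1 // => x _; rewrite andbC.
  by rewrite -IHn; apply: eq_bigr => x _.
rewrite E1 E2 {E1 E2 IHn}; set r := (#|T| - 2)%N.
case: a => [|a].
  rewrite !bin0 !mul1n !subn0 add0n.
  case: b => [|b]; first by rewrite !bin0 !mul1n !subn0 expnS.
  rewrite subSS binS; have [nb|bn] := leqP n b.
    by rewrite (bin_small (n := n) (m := b.+1)) //; lia.
  have -> : (n - b = (n - b.+1).+1)%N by lia.
  rewrite expnS; lia.
rewrite subSS binS; have [na|an] := leqP n a.
  rewrite (bin_small (n := n) (m := a.+1)) // !mul0n muln0 add0n.
  by case: b => [|b]; rewrite !addn0.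
have Ena : (n - a = (n - a.+1).+1)%N by lia.
rewrite Ena; set m := (n - a.+1)%N.
case: b => [|b].
  rewrite !bin0 !subn0 !muln1 expnS; lia.
rewrite binS subSS; have [mb|bm] := leqP m b.
  by rewrite (bin_small (n := m) (m := b.+1)) //; lia.
have -> : (m - b = (m - b.+1).+1)%N by lia.
rewrite expnS; lia.
Qed.

(** * Moments of the counter, as multiples of the number of words *)

Lemma rep_count_sum (T : finType) (A : {set T}) k n (x : n.-tuple T) :
  (rep_count A k x = \sum_(y in A) (count_mem y x == k))%N.
Proof.
rewrite /rep_count -sum1dep_card [LHS]big_mkcondr.
by apply: eq_bigr => y _; case: eqP.
Qed.

Lemma sum_rep_count (T : finType) (A : {set T}) k n :
  (\sum_(x : n.-tuple T) rep_count A k x =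
   #|A| * ('C(n, k) * #|T|.-1 ^ (n - k)))%N.
Proof.
under eq_bigr => x _ do rewrite rep_count_sum.
by rewrite exchange_big /=; under eq_bigr => y _ do rewrite sum_count_eq;
  rewrite sum_nat_const.
Qed.

Lemma sum_rep_count_sqr (T : finType) (A : {set T}) k n :
  (\sum_(x : n.-tuple T) rep_count A k x ^ 2 =
   #|A| * ('C(n, k) * #|T|.-1 ^ (n - k)) +
   #|A| * (#|A|.-1 * ('C(n, k) * 'C(n - k, k) * (#|T| - 2) ^ (n - k - k))))%N.
Proof.
transitivity (\sum_(y in A) \sum_(z in A) \sum_(x : n.-tuple T)
   ((count_mem y x == k) && (count_mem z x == k)))%N.
  under [RHS]eq_bigr => y _ do rewrite exchange_big /=.
  rewrite [RHS]exchange_big /=; apply: eq_bigr => x _.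
  rewrite rep_count_sum expnS expn1 big_distrlr /=.
  by apply: eq_bigr => y _; apply: eq_bigr => z _; rewrite mulnb.
rewrite -mulnDr -sum_nat_const; apply: eq_bigr => y yA.
rewrite (bigD1 y) //=; congr addn.
  by rewrite -(sum_count_eq y); apply: eq_bigr => x _; rewrite andbb.
rewrite (eq_bigr (fun=> 'C(n, k) * 'C(n - k, k) * (#|T| - 2) ^ (n - k - k)))%N.
  rewrite (cardsD1 y A) yA /= -sum_nat_const.
  by apply: eq_bigl => z; rewrite !inE andbC.
by move=> z /andP[_ zy]; rewrite sum_count_eq2 // eq_sym.
Qed.

(** * Binomial and multinomial probabilities *)

Definition binomial_pmf (R : realType) (q : R) (n k : nat) : R :=
  'C(n, k)%:R * q ^+ k * (1 - q) ^+ (n - k).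

(** The probability that two given letters, each of probability [q], both occur
    exactly [k] times in a random word of length [n]. *)
Definition multinomial_pmf (R : realType) (q : R) (n k : nat) : R :=
  'C(n, k)%:R * 'C(n - k, k)%:R * q ^+ (k + k) * (1 - 2 * q) ^+ (n - k - k).

(** The Poisson probability without its factor [expR (- mu)]; in this form,
    at mu = n * q, it bounds the binomial probability from above for every [n]. *)
Definition poisson_weight (R : realType) (mu : R) (k : nat) : R :=
  mu ^+ k / (k`!)%:R.

Lemma binomial_pmf_card (R : realType) (n k M : nat) : (0 < M)%N ->
  ('C(n, k) * M.-1 ^ (n - k))%:R =
  (M ^ n)%:R * binomial_pmf (M%:R^-1 : R) n k.
Proof.
move=> M0; rewrite /binomial_pmf; have [kn|nk] := leqP k n; last first.
  by rewrite bin_small // !mul0n !mul0r mulr0.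
have M0' : (M%:R : R) != 0 by rewrite pnatr_eq0 -lt0n.
have -> : (M ^ n = M ^ k * M ^ (n - k))%N by rewrite -expnD subnKC.
rewrite !natrM !natrX -(subn1 M) natrB //.
have -> : M%:R - 1 = M%:R * (1 - M%:R^-1) :> R by field.
rewrite exprMn exprVn; field.
by rewrite expf_neq0.
Qed.

Lemma multinomial_pmf_card (R : realType) (n k M : nat) : (1 < M)%N ->
  ('C(n, k) * 'C(n - k, k) * (M - 2) ^ (n - k - k))%:R =
  (M ^ n)%:R * multinomial_pmf (M%:R^-1 : R) n k.
Proof.
move=> M0; rewrite /multinomial_pmf; have [kn|nk] := leqP (k + k) n; last first.
  by rewrite (bin_small (n := n - k)%N); [rewrite !(muln0, mul0n, mulr0, mul0r)|lia].
have M0' : (M%:R : R) != 0 by rewrite pnatr_eq0 -lt0n; lia.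
have -> : (M ^ n = M ^ (k + k) * M ^ (n - k - k))%N.
  by rewrite -expnD -subnDA subnKC.
rewrite !natrM !natrX natrB //.
have -> : M%:R - 2 = M%:R * (1 - 2 * M%:R^-1) :> R by field.
rewrite exprMn exprVn; field.
by rewrite expf_neq0.
Qed.

Lemma ffact_le_expn n k : (n ^_ k <= n ^ k)%N.
Proof. by elim: k => // k IHk; rewrite ffactnSr expnSr leq_mul ?leq_subr. Qed.

Lemma bin_exp_le (R : realType) (q : R) n k : 0 <= q ->
  'C(n, k)%:R * q ^+ k <= poisson_weight (n%:R * q) k.
Proof.
move=> q0; rewrite /poisson_weight exprMn mulrAC ler_wpM2r ?exprn_ge0//.
rewrite ler_pdivlMr ?ltr0n ?fact_gt0// -natrM bin_ffact -natrX ler_nat.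
exact: ffact_le_expn.
Qed.

Lemma poisson_weight_ge0 (R : realType) (mu : R) k :
  0 <= mu -> 0 <= poisson_weight mu k.
Proof. by move=> mu0; rewrite divr_ge0 ?exprn_ge0. Qed.

Lemma poisson_weight_mulr_le1 (R : realType) (mu : R) k :
  0 <= mu -> mu <= 1 -> k%:R * poisson_weight mu k <= 1.
Proof.
move=> mu0 mu1; rewrite /poisson_weight mulrA ler_pdivrMr ?ltr0n ?fact_gt0//.
rewrite mul1r; apply: le_trans (_ : k%:R <= _).
  by rewrite ler_piMr// exprn_ile1.
by rewrite ler_nat fact_geq.
Qed.

Lemma binomial_pmf_le (R : realType) (q : R) n k : 0 <= q -> q <= 1 ->
  binomial_pmf q n k <= poisson_weight (n%:R * q) k.
Proof.
move=> q0 q1; apply: le_trans (bin_exp_le n k q0).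
rewrite /binomial_pmf ler_piMr ?mulr_ge0 ?exprn_ge0//.
by rewrite exprn_ile1; lra.
Qed.

Lemma bernoulli_ineq (R : realType) (q : R) n : 0 <= q -> q <= 1 ->
  1 - n%:R * q <= (1 - q) ^+ n.
Proof.
move=> q0 q1; elim: n => [|n IHn]; first by rewrite expr0; lra.
rewrite exprS -natr1; have n0 : 0 <= n%:R :> R by [].
by nra.
Qed.

(** Near negative correlation. Since 1 - 2q <= (1 - q)^2 and
    C(n - k, k) <= C(n, k), the joint probability times (1 - q)^(2k) is at most
    the square of the binomial probability; removing that factor costs a
    relative error of at most 2kq by Bernoulli's inequality. *)
Lemma multinomial_pmf_le (R : realType) (q : R) n k : 0 <= q -> 2 * q <= 1 ->
  multinomial_pmf q n k <=
  binomial_pmf q n k ^+ 2 + 2 * k%:R * q * poisson_weight (n%:R * q) k ^+ 2.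
Proof.
move=> q0 q2; set P := multinomial_pmf q n k.
have P0 : 0 <= P by rewrite !mulr_ge0 ?exprn_ge0//; lra.
have Pc : P <= poisson_weight (n%:R * q) k ^+ 2.
  rewrite /P /multinomial_pmf expr2.
  apply: (@le_trans _ _ (('C(n, k)%:R * q ^+ k) * ('C(n - k, k)%:R * q ^+ k))).
    rewrite exprD [leRHS](_ : _ = 'C(n, k)%:R * 'C(n - k, k)%:R * (q ^+ k * q ^+ k)); last by ring.
    by rewrite ler_piMr ?mulr_ge0 ?exprn_ge0// exprn_ile1; lra.
  apply: ler_pM; rewrite ?mulr_ge0 ?exprn_ge0 ?bin_exp_le//.
  apply: le_trans (bin_exp_le n k q0).
  by rewrite ler_wpM2r ?exprn_ge0// ler_nat leq_bin2l ?leq_subr.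
have PB : P * (1 - q) ^+ (k + k) <= binomial_pmf q n k ^+ 2.
  rewrite /P /multinomial_pmf /binomial_pmf.
  have [kn|nk] := leqP (k + k) n; last first.
    rewrite (bin_small (n := n - k)%N); last by lia.
    by rewrite !(mulr0, mul0r) sqr_ge0.
  have [m ->] : exists m, n = (k + (k + m))%N by exists (n - k - k)%N; lia.
  rewrite !addKn.
  have -> : ('C(k + (k + m), k)%:R * q ^+ k * (1 - q) ^+ (k + m)) ^+ 2 =
     'C(k + (k + m), k)%:R * 'C(k + (k + m), k)%:R * q ^+ (k + k) *
     ((1 - q) ^+ 2) ^+ m * (1 - q) ^+ (k + k).
    by rewrite -(exprM _ 2) mulnC exprM !exprD; ring.
  apply: ler_wpM2r; first by rewrite exprn_ge0//; lra.
  apply: ler_pM; rewrite ?mulr_ge0 ?exprn_ge0//; [lra| |].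
    by rewrite ler_wpM2r ?exprn_ge0// ler_wpM2l// ler_nat leq_bin2l// leq_addl.
  by rewrite lerXn2r ?nnegrE; nra.
have := bernoulli_ineq (k + k) q0 (_ : q <= 1); rewrite natrD => /(_ ltac:(lra)) B.
have k0 : 0 <= k%:R :> R by [].
have := ler_wpM2l P0 B.
have : (k%:R * q) * P <= (k%:R * q) * poisson_weight (n%:R * q) k ^+ 2.
  by rewrite ler_wpM2l// mulr_ge0.
lra.
Qed.

(** * Variance of the counter *)

(** Chebyshev's inequality for the counting measure. *)
Lemma chebyshev_card (R : realType) (I : finType) (f : I -> R) (a e : R) :
  0 <= e ->
  #|[set i | e <= `|f i - a|]%SET|%:R * e ^+ 2 <= \sum_i (f i - a) ^+ 2.
Proof.
move=> e0; rewrite -sum1dep_card natr_sum mulr_suml [leLHS]big_mkcond /=.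
apply: ler_sum => i _; case: ifP => [ei|_]; last exact: sqr_ge0.
by rewrite mul1r -[leRHS]real_normK ?num_real// lerXn2r ?nnegrE.
Qed.

(** The diagonal terms of the second moment contribute n * p <= n * c, where
    c = (n / M)^k / k!; the off-diagonal ones exceed (n * p)^2 by at most
    2 * n * (n / M) * (k * c) * c, where both n / M and k * c are at most 1. *)
Lemma variance_rep_count (R : realType) (T : finType) (A : {set T}) (n k : nat) :
  (1 < #|T|)%N -> (n <= #|T|)%N -> #|A| = n ->
  \sum_(x : n.-tuple T)
     ((rep_count A k x)%:R - n%:R * binomial_pmf (#|T|%:R^-1 : R) n k) ^+ 2 <=
  #|{: n.-tuple T}|%:R *
    (3 * n%:R * poisson_weight (n%:R / #|T|%:R) k).
Proof.
move=> M1 nM An; set M := #|T| in M1 nM *; set q : R := M%:R^-1.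
have M0 : 0 < M%:R :> R by rewrite ltr0n; lia.
have q0 : 0 <= q by rewrite invr_ge0 ltW.
have q2 : 2 * q <= 1 by rewrite ler_pdivrMr// mul1r ler_nat.
have mu1 : n%:R * q <= 1 by rewrite ler_pdivrMr// mul1r ler_nat.
have mu0 : 0 <= n%:R * q by rewrite mulr_ge0.
set p := binomial_pmf q n k; set c := poisson_weight _ k.
have c0 : 0 <= c by apply: poisson_weight_ge0.
have S1 : \sum_(x : n.-tuple T) (rep_count A k x)%:R = (M ^ n)%:R * (n%:R * p) :> R.
  rewrite -natr_sum sum_rep_count An natrM -/M (binomial_pmf_card R n k (ltnW M1)).
  by rewrite mulrCA.
have S2 : \sum_(x : n.-tuple T) (rep_count A k x)%:R ^+ 2 =
    (M ^ n)%:R * (n%:R * p + n%:R * (n.-1%:R * multinomial_pmf q n k)) :> R.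
  under eq_bigr => x _ do rewrite -natrX.
  rewrite -natr_sum sum_rep_count_sqr An -/M natrD (natrM _ n ('C(n, k) * _)%N).
  rewrite (natrM _ n (n.-1 * _)%N) (natrM _ n.-1).
  rewrite (binomial_pmf_card R n k (ltnW M1)) (multinomial_pmf_card R n k M1).
  by rewrite -/q -/p mulrDr !(mulrCA _ (M ^ n)%:R).
have -> : \sum_(x : n.-tuple T) ((rep_count A k x)%:R - n%:R * p) ^+ 2 =
  (M ^ n)%:R * (n%:R * p + n%:R * (n.-1%:R * multinomial_pmf q n k) - (n%:R * p) ^+ 2).
  transitivity (\sum_(x : n.-tuple T) ((rep_count A k x)%:R ^+ 2
      + ((- 2 * (n%:R * p)) * (rep_count A k x)%:R + (n%:R * p) ^+ 2))).
    by apply: eq_bigr => x _; ring.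
  rewrite !big_split /= S2 -mulr_sumr S1 sumr_const card_tuple -/M -mulr_natr.
  ring.
rewrite card_tuple -/M; apply: ler_wpM2l => //.
have P0 : 0 <= multinomial_pmf q n k by rewrite !mulr_ge0 ?exprn_ge0//; lra.
have H1 : n.-1%:R * multinomial_pmf q n k <= n%:R * multinomial_pmf q n k.
  by rewrite ler_wpM2r// ler_nat leq_pred.
have H2 : n%:R * (n.-1%:R * multinomial_pmf q n k) <= n%:R * (n%:R * multinomial_pmf q n k).
  by rewrite ler_wpM2l.
have H3 := multinomial_pmf_le n k q0 q2; rewrite -/p -/c in H3.
have H4 : n%:R * (n%:R * multinomial_pmf q n k) <=
  n%:R * (n%:R * (p ^+ 2 + 2 * k%:R * q * c ^+ 2)) by rewrite !ler_wpM2l.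
have H5 : n%:R * p <= n%:R * c by rewrite ler_wpM2l// binomial_pmf_le//; lra.
have H6 : k%:R * c <= 1 by apply: poisson_weight_mulr_le1.
have H7 : (n%:R * q) * (k%:R * c) <= 1.
  by rewrite mulr_ile1// mulr_ge0.
have H8 : (n%:R * c) * ((n%:R * q) * (k%:R * c)) <= n%:R * c.
  by rewrite ler_piMr// mulr_ge0.
rewrite -/c; lra.
Qed.

(** * Poisson approximation *)

Lemma exprn_lipschitz (R : realType) (x y : R) n :
  0 <= x <= 1 -> 0 <= y <= 1 -> `|x ^+ n - y ^+ n| <= n%:R * `|x - y|.
Proof.
move=> /andP[x0 x1] /andP[y0 y1]; elim: n => [|n IHn].
  by rewrite !expr0 subrr normr0 mul0r.
have -> : x ^+ n.+1 - y ^+ n.+1 = x * (x ^+ n - y ^+ n) + (x - y) * y ^+ n.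
  by rewrite !exprS; ring.
rewrite (le_trans (ler_normD _ _))// -natr1 [leRHS]mulrDl mul1r !normrM lerD//.
  by rewrite (ger0_norm x0) (le_trans _ IHn)// ler_piMl.
by rewrite ler_piMr// ger0_norm ?exprn_ge0// exprn_ile1.
Qed.

Lemma expRN_lipschitz (R : realType) (x y : R) :
  0 <= x -> 0 <= y -> `|expR (- x) - expR (- y)| <= `|x - y|.
Proof.
wlog xy : x y / x <= y => [hw x0 y0|x0 y0].
  have [/hw|/ltW/hw] := leP x y; first exact.
  by rewrite distrC (distrC x); exact.
have E : expR (- y) = expR (- x) * expR (- (y - x)) by rewrite -expRD; congr expR; ring.
have B : 1 - (y - x) <= expR (- (y - x)) by apply: expR_ge1Dx.
have E0 := expR_gt0 (- x).
have E1 : expR (- x) <= 1 by rewrite expR_le1; lra.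
have yx : expR (- y) <= expR (- x) by rewrite ler_expR; lra.
rewrite ger0_norm ?subr_ge0// ler0_norm; last lra.
have := ler_wpM2l (ltW E0) B; rewrite -E => H.
have : expR (- x) * (y - x) <= y - x by rewrite ler_piMl// subr_ge0.
lra.
Qed.

Lemma exp1B_near_expRN (R : realType) (q : R) n : 0 <= q -> q <= 1 ->
  expR (- (n%:R * q)) - n%:R * q ^+ 2 <= (1 - q) ^+ n.
Proof.
move=> q0 q1.
have Eq : 1 - q <= expR (- q) by apply: expR_ge1Dx.
have Eq1 : expR (- q) <= 1 by rewrite expR_le1; lra.
have Eq2 : expR (- q) <= 1 - q + q ^+ 2.
  have H : (1 + q) * expR (- q) <= 1.
    rewrite expRN ler_pdivrMr ?expR_gt0// mul1r; exact: expR_ge1Dx.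
  have := expR_ge0 (- q); nra.
have := @exprn_lipschitz R (expR (- q)) (1 - q) n.
rewrite expR_ge0 Eq1 subr_ge0 q1 gerBl q0 => /(_ isT isT).
rewrite -expRM_natl mulrN => /ler_normlW.
rewrite ger0_norm ?subr_ge0// => H.
have : n%:R * (expR (- q) - (1 - q)) <= n%:R * q ^+ 2 by rewrite ler_wpM2l//; lra.
lra.
Qed.

(** This is n^_k / n^k >= 1 - k^2 / n cleared of denominators, which keeps the
    induction free of divisions. *)
Lemma ffact_ge (R : realType) n k :
  (n%:R - k%:R ^+ 2) * n%:R ^+ k <= n%:R * (n ^_ k)%:R :> R.
Proof.
elim: k => [|k IHk]; first by rewrite ffactn0 expr0; lra.
have le_nk : (n ^_ k)%:R <= n%:R ^+ k :> R.
  by rewrite -natrX ler_nat ffact_le_expn.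
have nk : n%:R - k%:R <= (n - k)%:R :> R.
  by have [kn|/ltnW nk] := leqP k n; [rewrite natrB|rewrite (eqP nk) subr_le0 ler_nat].
rewrite ffactnSr natrM (exprSr _ k) -(natr1 k).
set N := n%:R in IHk le_nk nk *; set K := k%:R in IHk nk *.
set r := (n ^_ k)%:R in IHk le_nk *; set P := N ^+ k in IHk le_nk *.
have N0 : 0 <= N by []. have K0 : 0 <= K by [].
have r0 : 0 <= r by []. have P0 : 0 <= P by exact: exprn_ge0.
have H1 : N * r * (N - K) <= N * (r * (n - k)%:R).
  by rewrite -!mulrA !ler_wpM2l.
have H2 := ler_wpM2l N0 IHk.
have H3 : N * K * r <= N * K * P by rewrite ler_wpM2l ?mulr_ge0.
have H4 : 0 <= N * P * (K + 1) by rewrite !mulr_ge0 ?addr_ge0.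
lra.
Qed.

Lemma sqrn_le_fact k : (k ^ 2 + k + 1 <= 5 * k`!)%N.
Proof.
case: k => // [[|[|k]]] //; elim: k => // k IHk.
rewrite factS; nia.
Qed.

Lemma poisson_weight_le (R : realType) (mu : R) k :
  0 <= mu -> mu <= 1 -> (k ^ 2 + k + 1)%:R * poisson_weight mu k <= 5.
Proof.
move=> mu0 mu1; rewrite /poisson_weight mulrA ler_pdivrMr ?ltr0n ?fact_gt0//.
apply: le_trans (_ : (k ^ 2 + k + 1)%:R <= _).
  by rewrite ler_piMr// exprn_ile1.
by rewrite -natrM ler_nat sqrn_le_fact.
Qed.

(** Write w for the Poisson weight, E for exp(-nq) and B for (1 - q)^(n - k). The
    factor C(n, k) * q^k lies between w * (1 - k^2 / n) and w, and B between
    E - 1/n and E + k/n. The total error w * (k^2 + k + 1) / n is at most 5 / n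
    uniformly in k, because k! dominates k^2. *)
Lemma binomial_poisson (R : realType) (q : R) n k :
  (0 < n)%N -> (k <= n)%N -> 0 <= q -> n%:R * q <= 1 ->
  `|binomial_pmf q n k - poisson_weight (n%:R * q) k * expR (- (n%:R * q))|
    <= 5 / n%:R.
Proof.
move=> n0 kn q0 mu1; set N : R := n%:R in mu1 *.
have N0 : 0 < N by rewrite ltr0n.
have N1 : 1 <= N by rewrite ler1n.
have qN : q <= N^-1 by rewrite -[N^-1]mul1r ler_pdivlMr// mulrC.
have q1 : q <= 1 by apply: le_trans qN _; rewrite invf_le1.
have mu0 : 0 <= N * q by rewrite mulr_ge0// ltW.
set w := poisson_weight (N * q) k.
have w0 : 0 <= w by exact: poisson_weight_ge0.
set B := (1 - q) ^+ (n - k); set E := expR (- (N * q)).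
have B0 : 0 <= B by rewrite exprn_ge0// subr_ge0.
have B1 : B <= 1 by rewrite exprn_ile1//; lra.
have k0 : 0 <= k%:R :> R by [].
have kq : k%:R * q <= k%:R / N by rewrite ler_wpM2l.
have wK : w * (k%:R ^+ 2 + k%:R + 1) <= 5.
  by have := poisson_weight_le k mu0 mu1; rewrite !natrD natrX mulrC.
have BE : B <= E + k%:R / N.
  apply: le_trans (_ : expR (- ((N - k%:R) * q)) <= _).
    rewrite /N -natrB// -mulrN expRM_natl lerXn2r ?nnegrE ?expR_ge0 ?subr_ge0//.
    exact: expR_ge1Dx.
  have := @expRN_lipschitz R ((N - k%:R) * q) (N * q).
  rewrite mulr_ge0 ?subr_ge0 ?ler_nat// mu0 => /(_ isT isT) /ler_normlW.
  rewrite (_ : _ * q - N * q = - (k%:R * q)); last by ring.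
  rewrite normrN ger0_norm ?mulr_ge0// -/E; lra.
have EB : E - N^-1 <= B.
  have H1 : (1 - q) ^+ n <= B.
    by rewrite /B ler_wiXn2l ?subr_ge0// ?leq_subr//; lra.
  have := exp1B_near_expRN n q0 q1; rewrite -/N -/E.
  have : N * q ^+ 2 <= N^-1.
    rewrite expr2 mulrA -[leRHS]mul1r ler_pM//.
  lra.
have Cw : 'C(n, k)%:R * q ^+ k <= w by exact: bin_exp_le.
have wC : w - w * k%:R ^+ 2 / N <= 'C(n, k)%:R * q ^+ k.
  have F0 : 0 < (k`!)%:R :> R by rewrite ltr0n fact_gt0.
  have -> : w - w * k%:R ^+ 2 / N =
     ((N - k%:R ^+ 2) * N ^+ k) * (q ^+ k / (k`!)%:R / N).
    rewrite /w /poisson_weight exprMn; field.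
    by rewrite !gt_eqF.
  have -> : 'C(n, k)%:R * q ^+ k = (N * (n ^_ k)%:R) * (q ^+ k / (k`!)%:R / N).
    by rewrite -bin_ffact natrM; field; rewrite !gt_eqF.
  rewrite ler_wpM2r ?ffact_ge// !divr_ge0 ?exprn_ge0//; exact: ltW.
rewrite /binomial_pmf -/B.
set c := 'C(n, k)%:R * q ^+ k in Cw wC *.
have U : c * B <= w * (E + k%:R / N).
  by apply: le_trans (ler_wpM2l w0 BE); rewrite ler_wpM2r.
have L1 : (w - w * k%:R ^+ 2 / N) * B <= c * B by rewrite ler_wpM2r.
have L2 : w * (E - N^-1) <= w * B by rewrite ler_wpM2l.
have L3 : w * k%:R ^+ 2 / N * B <= w * k%:R ^+ 2 / N.
  by rewrite ler_piMr// divr_ge0 ?mulr_ge0 ?exprn_ge0// ltW.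
have V0 : 0 <= N^-1 by rewrite invr_ge0 ltW.
have wKN := ler_wpM2r V0 wK.
have P1 : 0 <= w * k%:R * N^-1 by rewrite mulr_ge0// mulr_ge0.
have P2 : 0 <= w * k%:R ^+ 2 * N^-1 by rewrite mulr_ge0// mulr_ge0// exprn_ge0.
have P3 : 0 <= w * N^-1 by rewrite mulr_ge0.
rewrite ler_norml; apply/andP; split; lra.
Qed.

Lemma poisson_lipschitz (R : realType) (x y : R) k :
  0 <= x -> x <= 1 -> 0 <= y -> y <= 1 ->
  `|poisson_weight x k * expR (- x) - poisson_weight y k * expR (- y)|
    <= 2 * `|x - y|.
Proof.
move=> x0 x1 y0 y1; rewrite /poisson_weight.
have F0 : 0 < (k`!)%:R :> R by rewrite ltr0n fact_gt0.
have -> : x ^+ k / (k`!)%:R * expR (- x) - y ^+ k / (k`!)%:R * expR (- y) =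
  (x ^+ k - y ^+ k) / (k`!)%:R * expR (- x)
  + y ^+ k / (k`!)%:R * (expR (- x) - expR (- y)) by ring.
rewrite (le_trans (ler_normD _ _))//.
have H1 : `|(x ^+ k - y ^+ k) / (k`!)%:R * expR (- x)| <= `|x - y|.
  rewrite !normrM (ger0_norm (expR_ge0 _)) normfV (ger0_norm (ltW F0)).
  have ex1 : expR (- x) <= 1 by rewrite expR_le1; lra.
  rewrite -[leRHS]mulr1 ler_pM ?divr_ge0 ?expR_ge0 ?(ltW F0)//.
  rewrite ler_pdivrMr// (le_trans (exprn_lipschitz k _ _)) ?x0 ?y0// mulrC.
  by rewrite ler_wpM2l// ler_nat fact_geq.
have H2 : `|y ^+ k / (k`!)%:R * (expR (- x) - expR (- y))| <= `|x - y|.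
  rewrite normrM -[leRHS]mul1r ler_pM ?expRN_lipschitz//.
  rewrite ger0_norm ?divr_ge0 ?exprn_ge0 ?(ltW F0)// ler_pdivrMr// mul1r.
  by rewrite (le_trans (exprn_ile1 _ y0 y1))// ler1n fact_gt0.
lra.
Qed.

(** * Frequency of the concentrated words *)

Lemma sum_count_mem (T : finType) (s : seq T) :
  (\sum_(y : T) count_mem y s = size s)%N.
Proof.
elim: s => [|x s IHs] /=; first by rewrite big1.
rewrite big_split /= IHs (bigD1 x) //= eqxx big1 // => y.
by rewrite eq_sym => /negbTE ->.
Qed.

Lemma rep_count_mul_le (T : finType) (A : {set T}) k n (x : n.-tuple T) :
  (rep_count A k x * k <= n)%N.
Proof.
rewrite rep_count_sum big_distrl /= -[leqRHS](size_tuple x) -sum_count_mem.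
rewrite [leqRHS](bigID (mem A)) /= (leq_trans _ (leq_addr _ _))// leq_sum// => y _.
by case: eqP => [->|]; rewrite ?mul1n ?mul0n.
Qed.

Lemma concentrated_freq_le1 (R : realType) (T : finType) (A : {set T}) k n
    (lambda delta : R) : concentrated_freq A k n lambda delta <= 1.
Proof.
rewrite /concentrated_freq; have [->|N0] := posnP #|{: n.-tuple T}|.
  by rewrite invr0 mulr0.
by rewrite ler_pdivrMr ?ltr0n// mul1r ler_nat max_card.
Qed.

(** Both m_k / n and the Poisson probability lie between 0 and 1/k, and the latter
    strictly so at both ends, which gives the strict inequality. *)
Lemma concentrated_freq_eq1 (R : realType) (T : finType) (A : {set T}) k n
    (lambda delta : R) :
  (0 < n)%N -> (0 < #|T|)%N -> 0 < lambda -> lambda <= 1 -> (0 < k)%N ->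
  1 <= k%:R * n%:R `^ (- delta) ->
  concentrated_freq A k n lambda delta = 1.
Proof.
move=> n0 T0 l0 l1 k0 ke; rewrite /concentrated_freq.
have -> : concentrated A k n lambda delta = [set: n.-tuple T]%SET.
  apply/setP => x; rewrite !inE.
  have k0R : 0 < k%:R :> R by rewrite ltr0n.
  have n0R : 0 < n%:R :> R by rewrite ltr0n.
  have ek : k%:R^-1 <= n%:R `^ (- delta) by rewrite -[k%:R^-1]mul1r ler_pdivrMr// mulrC.
  apply: lt_le_trans ek.
  have a0 : 0 <= (rep_count A k x)%:R / n%:R :> R by rewrite divr_ge0.
  have a1 : (rep_count A k x)%:R / n%:R <= k%:R^-1 :> R.
    rewrite ler_pdivrMr// mulrC ler_pdivlMr// -natrM ler_nat.
    exact: rep_count_mul_le.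
  have b0 : 0 < lambda ^+ k / (k`!)%:R * expR (- lambda).
    by rewrite mulr_gt0 ?expR_gt0// divr_gt0 ?exprn_gt0// ltr0n fact_gt0.
  have b1 : lambda ^+ k / (k`!)%:R * expR (- lambda) < k%:R^-1.
    apply: le_lt_trans (_ : k%:R^-1 * expR (- lambda) < _).
      rewrite ler_wpM2r ?expR_ge0// -[leRHS]mul1r.
      rewrite ler_pM ?exprn_ge0 ?exprn_ile1 ?invr_ge0 ?(ltW l0)//.
      by rewrite lef_pV2 ?posrE ?ltr0n ?fact_gt0// ler_nat fact_geq.
    by rewrite gtr_pMr ?invr_gt0// expR_lt1; lra.
  rewrite ltr_norml; apply/andP; split; lra.
by rewrite cardsT divff// pnatr_eq0 card_tuple -lt0n expn_gt0 T0.
Qed.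

(** If the bias of the mean is at most half the tolerance, a word that is not
    concentrated deviates from the mean by at least the other half, and
    Chebyshev's inequality applies. *)
Lemma concentrated_freq_chebyshev (R : realType) (T : finType) (A : {set T}) (n k : nat)
    (lambda delta : R) :
  (0 < n)%N -> (1 < #|T|)%N -> (n <= #|T|)%N -> #|A| = n ->
  2 * `|binomial_pmf (#|T|%:R^-1) n k - poisson_weight lambda k * expR (- lambda)|
    <= n%:R `^ (- delta) ->
  1 - concentrated_freq A k n lambda delta <=
    12 * (poisson_weight (n%:R / #|T|%:R) k / (n%:R * (n%:R `^ (- delta)) ^+ 2)).
Proof.
move=> n0 M1 nM An; set e := n%:R `^ _; set p := binomial_pmf _ n k.
have n0R : 0 < n%:R :> R by rewrite ltr0n.
have e0 : 0 < e by exact: powR_gt0.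
rewrite /poisson_weight; set pi := _ * expR _ => bias.
set c := _ / (k`!)%:R.
set tot := #|{: n.-tuple T}|.
have tot0 : 0 < tot%:R :> R by rewrite ltr0n /tot card_tuple expn_gt0; lia.
set G := concentrated A k n lambda delta.
set D := [set x : n.-tuple T | n%:R * e / 2 <= `|(rep_count A k x)%:R - n%:R * p| ]%SET.
have GD : (tot <= #|G| + #|D|)%N.
  rewrite /tot -(cardsC G) leq_add2l subset_leq_card//.
  apply/fintype.subsetP => x; rewrite !inE -leNgt -/pi -/e.
  set m := (rep_count A k x)%:R => em.
  have -> : m - n%:R * p = n%:R * (m / n%:R - p) by field; rewrite gt_eqF.
  rewrite normrM gtr0_norm// -mulrA ler_pM2l//.
  have := ler_normD (m / n%:R - p) (p - pi).
  rewrite (_ : m / n%:R - p + (p - pi) = m / n%:R - pi); last by ring.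
  lra.
have cheb : #|D|%:R * (n%:R * e / 2) ^+ 2 <= tot%:R * (3 * n%:R * c).
  apply: le_trans (variance_rep_count R k M1 nM An).
  apply: chebyshev_card.
  by rewrite divr_ge0 ?mulr_ge0 ?(ltW e0).
have D1 : 1 - concentrated_freq A k n lambda delta <= #|D|%:R / tot%:R.
  rewrite /concentrated_freq -/G -/tot ler_pdivlMr// mulrBl mul1r divfK ?gt_eqF//.
  by rewrite lerBlDl -natrD ler_nat.
apply: le_trans D1 _; rewrite ler_pdivrMr// -(ler_pM2r (_ : 0 < (n%:R * e / 2) ^+ 2)); last first.
  by rewrite exprn_gt0// divr_gt0// mulr_gt0.
apply: le_trans cheb _; rewrite le_eqVlt; apply/orP; left; apply/eqP.
by field; rewrite !gt_eqF.
Qed.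

(* C gamma is the implied constant of the hypothesis: it may depend on gamma
   but not on lambda and k.  K is the implied constant of the conclusion. *)
Theorem theorem1 (R : realType) (C : R -> R) :
  exists K : R, forall gamma : R, 0 <= gamma -> gamma < 1 ->
  exists n0 : nat, forall n : nat, (n0 <= n)%N ->
  forall (lambda delta : R) (k : nat) (T : finType) (A : {set T}),
  0 < lambda -> lambda <= 1 ->
  0 < delta -> delta < (1 - gamma) / 2 ->
  (k <= n)%N -> (n <= #|T|)%N ->
  `|#|T|%:R - n%:R / lambda| <= C gamma * n%:R `^ gamma ->
  #|A| = n ->
  `|concentrated_freq A k n lambda delta - 1| <=
    K * (lambda ^+ k / (k`!)%:R * (1 / n%:R `^ (1 - 2 * delta)) *
         (1 + lambda ^+ k.+1 * (lambda + k%:R) / (k`!)%:R * n%:R `^ gamma)).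
Proof.
(* 12 comes from Chebyshev's inequality, expR 1 bounds (mu / lambda)^k. *)
exists (12 * expR 1) => gamma g0 g1.
set eta := (1 - gamma) / 2; set c := `|C gamma|.
have eta0 : 0 < eta by rewrite divr_gt0 // subr_gt0.
have c0 : 0 <= c by rewrite normr_ge0.
(* The threshold ensures (10 + 4 |C gamma|) n^(-eta) <= 1. As 1/n <= n^(-2 eta),
   it makes twice the bias 5/n + 2 |C gamma| n^(-2 eta) at most n^(-eta); it
   also gives |C gamma| n^(-eta) <= 1, used for (mu / lambda)^k. *)
exists (Num.truncn ((10 + 4 * c) `^ eta^-1)).+2 => n n0n lambda delta k T A.
move=> l0 l1 d0 d1 kn nM hM An.
have n2 : (1 < n)%N by apply: leq_trans n0n.
have n0' : (0 < n)%N := ltnW n2.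
have M1 : (1 < #|T|)%N := leq_trans n2 nM.
have N1 : 1 <= n%:R :> R by rewrite ler1n.
have N0 : 0 < n%:R :> R by rewrite ltr0n.
have M0 : 0 < #|T|%:R :> R by rewrite ltr0n ltnW.
set N : R := n%:R in N1 N0 hM *; set M : R := #|T|%:R in M0 hM.
have NM : N <= M by rewrite ler_nat.
have hN : 10 + 4 * c <= N `^ eta.
  have b0 : 0 <= 10 + 4 * c by rewrite addr_ge0 ?mulr_ge0.
  have bN : (10 + 4 * c) `^ eta^-1 <= N.
    apply: le_trans (ltW (truncnS_gt _)) _.
    by rewrite ler_nat; apply: leq_trans n0n.
  have -> : 10 + 4 * c = ((10 + 4 * c) `^ eta^-1) `^ eta.
    by rewrite -powRrM mulVf ?lt0r_neq0// powRr1.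
  by apply: ge0_ler_powR; rewrite ?nnegrE ?powR_ge0//; exact: ltW.
set w := N `^ (- eta).
have w0 : 0 < w by exact: powR_gt0.
have hw : (10 + 4 * c) * w <= 1.
  by rewrite /w powRN ler_pdivrMr ?powR_gt0// mul1r.
have w2 : N `^ gamma = N * w ^+ 2.
  rewrite /w -powR_mulrn ?powR_ge0// -powRrM -{2}(powRr1 (ltW N0)) -powRD.
    by congr powR; rewrite /eta; lra.
  by rewrite (gt_eqF N0) implybT.
have Nw : N^-1 <= w ^+ 2.
  rewrite -[leLHS]mul1r ler_pdivrMr// mulrC -w2.
  by rewrite -(powRr0 N) ler_powR.
set e := N `^ (- delta).
have we : w <= e by rewrite ler_powR// lerN2 ltW.
have e0 : 0 < e by exact: powR_gt0.
have e2 : N `^ (1 - 2 * delta) = N * e ^+ 2.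
  rewrite /e -powR_mulrn ?powR_ge0// -powRrM -{2}(powRr1 (ltW N0)) -powRD.
    by congr powR; lra.
  by rewrite (gt_eqF N0) implybT.
have F0 : 0 < (k`!)%:R :> R by rewrite ltr0n fact_gt0.
have W0 : 0 <= lambda ^+ k / (k`!)%:R * (1 / N `^ (1 - 2 * delta)).
  by rewrite mulr_ge0 ?divr_ge0 ?exprn_ge0 ?powR_ge0// ltW.
have X0 : 0 <= lambda ^+ k.+1 * (lambda + k%:R) / (k`!)%:R * N `^ gamma.
  rewrite mulr_ge0 ?powR_ge0// divr_ge0 ?(ltW F0)// mulr_ge0 ?exprn_ge0 ?(ltW l0)//.
  by rewrite addr_ge0// ltW.
have K0 : 0 <= 12 * expR 1 :> R by rewrite mulr_ge0 ?expR_ge0.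
have [ke|ke] := leP 1 (k%:R * e).
  have k0 : (0 < k)%N.
    by move: ke; case: (k) => //; rewrite mul0r ler10.
  rewrite (concentrated_freq_eq1 A _ _ l0 l1 k0 ke); [|by []|exact: ltnW].
  rewrite subrr normr0; apply: mulr_ge0 => //; apply: mulr_ge0 => //.
  exact: addr_ge0.
have kw : k%:R * w <= 1 by rewrite (le_trans _ (ltW ke))// ler_wpM2l.
have cN : `|M - N / lambda| <= c * N `^ gamma.
  by rewrite (le_trans hM)// ler_wpM2r ?powR_ge0// ler_norm.
have mul : `|N / M - lambda| <= lambda * (c * w ^+ 2).
  have -> : N / M - lambda = - (lambda / M * (M - N / lambda)).
    by field; rewrite !gt_eqF.
  rewrite normrN normrM ger0_norm ?divr_ge0 ?(ltW l0) ?(ltW M0)//.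
  rewrite -mulrA ler_wpM2l ?(ltW l0)// ler_pdivrMl//.
  apply: le_trans cN _; rewrite w2.
  rewrite (_ : M * (c * w ^+ 2) = c * (M * w ^+ 2)); last by ring.
  by rewrite ler_wpM2l// ler_wpM2r// exprn_ge0// ltW.
have mu0 : 0 <= N / M by rewrite divr_ge0 ?ltW.
have mu1 : N / M <= 1 by rewrite ler_pdivrMr// mul1r.
have cw0 : 0 <= c * w ^+ 2 by rewrite mulr_ge0 ?exprn_ge0 ?(ltW w0).
have bias : 2 * `|binomial_pmf M^-1 n k - poisson_weight lambda k * expR (- lambda)| <= e.
  have B1 := @binomial_poisson R M^-1 n k n0' kn (ltac:(by rewrite invr_ge0 ltW)) mu1.
  have B2 := poisson_lipschitz k mu0 mu1 (ltW l0) l1.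
  rewrite -/N in B1.
  have B3 := le_trans (ler_distD (poisson_weight (N / M) k * expR (- (N / M))) _ _) (lerD B1 B2).
  have B4 : lambda * (c * w ^+ 2) <= c * w ^+ 2 by rewrite ler_piMl.
  have B5 : (10 + 4 * c) * w * w <= w by rewrite ler_piMl// ltW.
  by rewrite expr2 in Nw B4 mul; lra.
have growth : poisson_weight (N / M) k <= expR 1 * poisson_weight lambda k.
  rewrite /poisson_weight mulrA ler_wpM2r ?invr_ge0 ?(ltW F0)//.
  apply: le_trans (_ : (lambda * (1 + c * w ^+ 2)) ^+ k <= _).
    have lc0 : 0 <= lambda * (1 + c * w ^+ 2).
      by apply: mulr_ge0; [exact: ltW|exact: addr_ge0].
    apply: lerXn2r; rewrite ?nnegrE//.
    rewrite mulrDr mulr1 -lerBlDl; exact: ler_normlW.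
  rewrite exprMn mulrC ler_wpM2r ?exprn_ge0 ?(ltW l0)//.
  apply: le_trans (_ : expR (c * w ^+ 2) ^+ k <= _).
    by rewrite lerXn2r ?nnegrE ?addr_ge0 ?expR_ge0// expR_ge1Dx.
  rewrite -expRM_natl ler_expR.
  have cw : c * w <= 1.
    by have : 0 <= (10 + 3 * c) * w; [rewrite mulr_ge0 ?addr_ge0 ?mulr_ge0 ?(ltW w0)|lra].
  rewrite [leLHS](_ : _ = (c * w) * (k%:R * w)); last by ring.
  by rewrite mulr_ile1// ?mulr_ge0 ?(ltW w0).
rewrite distrC ger0_norm ?subr_ge0 ?concentrated_freq_le1//.
apply: le_trans (concentrated_freq_chebyshev n0' M1 nM An bias) _.
rewrite -/N -/M -/e -e2 -mulrA; apply: ler_wpM2l => //.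
have S1 : poisson_weight (N / M) k / N `^ (1 - 2 * delta) <=
          expR 1 * (lambda ^+ k / (k`!)%:R * (1 / N `^ (1 - 2 * delta))).
  by rewrite mulrA div1r ler_wpM2r// invr_ge0 powR_ge0.
apply: le_trans S1 _; rewrite ler_wpM2l ?expR_ge0// ler_peMr//.
by rewrite lerDl.
Qed.
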